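(* There is an absolute constant $\Delta_1$ such that every digraph $D$ without digons and with $\tilde{\Delta}(D) \geq \Delta_1$ satisfies $\chi(D) \leq \left(1 - e^{-13}\right)\tilde{\Delta}(D)$.
   Context: All digraphs are finite and simple: no loops, and no two arcs with the same initial and the same terminal vertex (two oppositely directed arcs between the same pair of vertices are allowed in general). A digon is a directed cycle on exactly two vertices, i.e. a pair of arcs $xy$ and $yx$. For a vertex $v$, $d^{+}(v)$ and $d^{-}(v)$ denote its out-degree and in-degree. $\tilde{\Delta}(D) = \max\{\sqrt{d^{+}(v)d^{-}(v)} : v \in V(D)\}$. A set $A \subseteq V(D)$ is acyclic if the induced subdigraph $D[A]$ has no directed cycle. A $k$-coloring of $D$ is a partition of $V(D)$ into $k$ acyclic sets (equivalently, an assignment of one of $k$ colors to each vertex such that each color class induces an acyclic subdigraph), and the chromatic number $\chi(D)$ is the least $k$ for which a $k$-coloring exists. *)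

(* Defs.v *)
From mathcomp Require Import all_boot all_order all_algebra.
From mathcomp Require Import boolp reals sequences exp.

Set Implicit Arguments.
Unset Strict Implicit.
Unset Printing Implicit Defensive.

Import Order.TTheory GRing.Theory Num.Theory.

Local Open Scope ring_scope.

Record digraph := Digraph {
  vertex :> finType;
  darc : rel vertex;
  darc_irr : irreflexive darc }.

Arguments darc {d} _ _.

Section Digraph.
Variable D : digraph.

Definition outdeg (v : D) : nat := #|[set w | darc v w]|.
Definition indeg (v : D) : nat := #|[set w | darc w v]|.

Definition digon (x y : D) : bool := [&& x != y, darc x y & darc y x].

Definition digon_free : Prop := forall x y : D, ~~ digon x y.

(* A directed cycle is given by the sequence of its (distinct) vertices;
   [ucycle] also holds of the empty sequence, which has to be excluded. *)
Definition dicycle (c : seq D) : Prop := c <> [::] /\ ucycle darc c.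

Definition acyclic (A : {set D}) : Prop :=
  ~ exists c : seq D, dicycle c /\ {subset c <= A}.

Definition is_coloring (k : nat) (f : D -> 'I_k) : Prop :=
  forall i : 'I_k, acyclic [set v | f v == i].

Definition colorable (k : nat) : Prop := exists f : D -> 'I_k, is_coloring f.

Lemma acyclic_set1 (v : D) : acyclic [set v].
Proof.
move=> [[|x [|y c]] [[// _ /andP[cc uc]] sub]].
  by move: cc; rewrite /= darc_irr.
move: uc; have /set1P-> : x \in [set v] by apply: sub; rewrite mem_head.
have /set1P-> : y \in [set v] by apply: sub; rewrite !inE eqxx orbT.
by rewrite /= mem_head.
Qed.

Lemma colorable_exists : exists k, `[< colorable k >].
Proof.
exists #|D|; apply/asboolP; exists enum_rank => i.
suff -> : [set v | enum_rank v == i] = [set enum_val i]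
  by exact: acyclic_set1.
by apply/setP => v; rewrite !inE (can2_eq enum_rankK enum_valK).
Qed.

Definition chromatic_number : nat := ex_minn colorable_exists.

(* The base value 0 only matters for the digraph without vertices, since the
   square roots are nonnegative. *)
Definition Delta_tilde (R : realType) : R :=
  \big[Num.max/0]_(v : D) Num.sqrt ((outdeg v)%:R * (indeg v)%:R).

End Digraph.

(* Main.v *)
(** The bound holds with room to spare, and without randomness: if
    [6 s^2 > d+(v) d-(v)] for all [v], then [2 s] colors suffice, i.e. about
    [0.82 Delta_tilde] colors.

    In a minimal vertex set [S] that is not [2 s]-colorable, all in- and
    out-degrees are at least [2 s], so the bound on their product gives
    [d+ + d- < 5 s] within [S]. A partition of [S] into [s] parts with the
    fewest arcs inside the parts has total degree at most 4 inside each part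
    (Lovász). So it remains to color a digon-free digraph of total degree at
    most 4 with two colors.

    In a minimal counterexample every vertex [v] has, in any 2-coloring of the
    rest, exactly one in- and one out-neighbor of each color, and the uncolored
    "hole" can be moved from [v] to any neighbor. Giving the hole a color
    closes a monochromatic directed cycle; recoloring a vertex [y] of this cycle
    leaves a monochromatic path [Q] of at least two vertices and creates a cycle
    of the other color, from which the next vertex is recolored, and so on. The
    hole can never come back to [Q], which would give a contradiction at [y];
    hence the recolored vertices are pairwise distinct, and there are infinitely
    many of them. *)

Require Import Defs.
From mathcomp Require Import all_boot all_order all_algebra.
From mathcomp Require Import boolp reals sequences exp.
From mathcomp Require Import zify lra.
Set Implicit Arguments.
Unset Strict Implicit.
Unset Printing Implicit Defensive.

Import Order.TTheory GRing.Theory Num.Theory.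
Local Open Scope ring_scope.

(** * Acyclic colorings via rank functions, and critical sets *)

Section Colors.
Local Open Scope nat_scope.
Variables (T : finType) (e : rel T).
Hypothesis e_irr : irreflexive e.

(* The color classes are acyclic: a single rank function increases along all
   monochromatic arcs. *)
Definition colors (K : eqType) (S : {set T}) (f : T -> K) : Prop :=
  exists r : T -> nat,
    {in S &, forall x y, e x y -> f x = f y -> r x < r y}.

Lemma colors_sub (K : eqType) (S S' : {set T}) (f : T -> K) :
  S' \subset S -> colors S f -> colors S' f.
Proof.
move=> /subsetP sS [r rP]; exists r => x y xS yS; apply: rP; exact: sS.
Qed.

Lemma eq_colors (K K' : eqType) (S : {set T}) (f : T -> K) (g : T -> K') :
  {in S &, forall x y, g x = g y -> f x = f y} -> colors S f -> colors S g.
Proof.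
move=> fg [r rP]; exists r => x y xS yS exy /fg fxy.
by apply: rP => //; exact: fxy.
Qed.

(** [v] can be ranked above all other vertices if it has no out-neighbor of its color, and below
    them if it has no such in-neighbor. *)
Lemma colors_extend (K : eqType) (S : {set T}) (f : T -> K) (v : T) :
  colors (S :\ v) f ->
  {in S, forall u, e v u -> f u != f v} \/
  {in S, forall u, e u v -> f u != f v} ->
  colors S f.
Proof.
move=> [r rP] [no|no].
- exists (fun u => if u == v then (\max_w r w).+1 else r u) => x y xS yS exy fxy.
  have [xv|xv] := eqVneq x v.
    by move: (no y yS); rewrite -xv exy -fxy eqxx => /(_ isT).
  have [yv|yv] := eqVneq y v; first by rewrite ltnS leq_bigmax.
  by apply: rP; rewrite // !inE ?xv ?yv.
- exists (fun u => if u == v then 0 else (r u).+1) => x y xS yS exy fxy.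
  have [yv|yv] := eqVneq y v.
    by move: (no x xS); rewrite -yv exy fxy eqxx => /(_ isT).
  have [xv|xv] := eqVneq x v; first by [].
  by rewrite ltnS; apply: rP; rewrite // !inE ?xv ?yv.
Qed.

(** A vertex of maximal rank in [Z] would need a successor of larger rank. *)
Lemma colors_no_forward_closed (K : eqType) (S Z : {set T}) (f : T -> K) (w : T) :
  colors S f -> Z \subset S -> w \in Z ->
  ~ (forall u, u \in Z -> exists2 u', u' \in Z & e u u' /\ f u = f u').
Proof.
move=> [r rP] /subsetP ZS wZ next.
case: (arg_maxnP r wZ) => u uZ umax.
have [u' u'Z [euu' fuu']] := next u uZ.
by have := rP _ _ (ZS _ uZ) (ZS _ u'Z) euu' fuu'; rewrite ltnNge => /negP; apply; exact: umax.
Qed.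

Lemma colors_no_backward_closed (K : eqType) (S Z : {set T}) (f : T -> K) (w : T) :
  colors S f -> Z \subset S -> w \in Z ->
  ~ (forall u, u \in Z -> exists2 u', u' \in Z & e u' u /\ f u' = f u).
Proof.
move=> [r rP] /subsetP ZS wZ next.
case: (arg_minnP r wZ) => u uZ umin.
have [u' u'Z [eu'u fu'u]] := next u uZ.
by have := rP _ _ (ZS _ u'Z) (ZS _ uZ) eu'u fu'u; rewrite ltnNge => /negP; apply; exact: umin.
Qed.

Lemma minimal_uncolorable (K : eqType) (A : {set T}) :
  inhabited K -> ~ (exists f : T -> K, colors A f) ->
  exists S : {set T}, [/\ S \subset A, ~ (exists f : T -> K, colors S f),
    forall v, v \in S -> exists f : T -> K, colors (S :\ v) f & S != set0].
Proof.
move=> [k0] nA.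
have PA : `[< ~ (exists f : T -> K, colors A f) >] by apply/asboolP.
case: (minset_exists (P := fun S : {set T} =>
  `[< ~ (exists f : T -> K, colors S f) >]) PA) => S /minsetP[/asboolP nS minS] SA.
exists S; split=> // [v vS|].
  apply: contrapT => nSv.
  have /asboolP/minS/(_ (subD1set _ _))/setP/(_ v) := nSv.
  by rewrite !inE eqxx vS.
apply/negP => /eqP S0; apply: nS; exists (fun=> k0); exists (fun=> 0).
by move=> x y; rewrite S0 inE.
Qed.

Definition recolor (K : Type) (f : T -> K) (v : T) (c : K) : T -> K :=
  fun u => if u == v then c else f u.

Lemma recolor_at (K : Type) (f : T -> K) v c : recolor f v c v = c.
Proof. by rewrite /recolor eqxx. Qed.

Lemma recolor_off (K : Type) (f : T -> K) v c u :
  u != v -> recolor f v c u = f u.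
Proof. by rewrite /recolor => /negbTE->. Qed.

Lemma colors_recolor (K : eqType) (S : {set T}) (f : T -> K) v c :
  colors (S :\ v) f -> colors (S :\ v) (recolor f v c).
Proof.
apply: eq_colors => x y; rewrite !inE => /andP[xv _] /andP[yv _].
by rewrite !recolor_off.
Qed.

Definition odeg (S : {set T}) (v : T) : nat := #|[set u in S | e v u]|.
Definition ideg (S : {set T}) (v : T) : nat := #|[set u in S | e u v]|.

(** Otherwise [v] could take the color [c], by [colors_extend]. *)
Lemma critical_out (K : eqType) (S : {set T}) (f : T -> K) (v : T) (c : K) :
  ~ (exists f : T -> K, colors S f) -> colors (S :\ v) f ->
  exists u, [/\ u \in S, e v u & f u = c].
Proof.
move=> nS fv; apply: contrapT => no; apply: nS.
exists (recolor f v c); apply: (colors_extend (v := v)); first exact: colors_recolor.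
left=> u uS evu; rewrite recolor_at recolor_off; last first.
  by apply: contraTneq evu => ->; rewrite e_irr.
by apply/eqP => fu; apply: no; exists u.
Qed.

Lemma critical_in (K : eqType) (S : {set T}) (f : T -> K) (v : T) (c : K) :
  ~ (exists f : T -> K, colors S f) -> colors (S :\ v) f ->
  exists u, [/\ u \in S, e u v & f u = c].
Proof.
move=> nS fv; apply: contrapT => no; apply: nS.
exists (recolor f v c); apply: (colors_extend (v := v)); first exact: colors_recolor.
right=> u uS euv; rewrite recolor_at recolor_off; last first.
  by apply: contraTneq euv => ->; rewrite e_irr.
by apply/eqP => fu; apply: no; exists u.
Qed.

Lemma critical_degrees (K : finType) (S : {set T}) (f : T -> K) (v : T) :
  ~ (exists f : T -> K, colors S f) -> colors (S :\ v) f ->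
  #|K| <= odeg S v /\ #|K| <= ideg S v.
Proof.
move=> nS fv; split.
- apply: leq_trans (leq_imset_card f _); rewrite -cardsT subset_leq_card //.
  apply/subsetP => c _; have [u [uS evu <-]] := critical_out c nS fv.
  by apply: imset_f; rewrite inE uS.
- apply: leq_trans (leq_imset_card f _); rewrite -cardsT subset_leq_card //.
  apply/subsetP => c _; have [u [uS euv <-]] := critical_in c nS fv.
  by apply: imset_f; rewrite inE uS.
Qed.

(** * Two colors for total degree at most 4: moving the hole *)

Section DegreeFour.
Hypothesis no_digon : forall x y, e x y -> ~~ e y x.
Variable S : {set T}.
Hypothesis notcol : ~ (exists f : T -> bool, colors S f).
Hypothesis deg4 : forall v, v \in S -> odeg S v + ideg S v <= 4.

(* The value [g v] is irrelevant here. *)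
Definition hole (g : T -> bool) (v : T) : Prop := v \in S /\ colors (S :\ v) g.

(** A third out-neighbor has the other color, and the in-degree is at least 2, so the total degree
    would exceed 4. *)
Lemma hole_out_uniq g v u u' : hole g v -> u \in S -> u' \in S ->
  e v u -> e v u' -> g u = g u' -> u = u'.
Proof.
move=> [vS gv] uS u'S evu evu' guu'; apply/eqP/negPn/negP => uu'.
have [a [aS eva ga]] := critical_out (~~ g u) notcol gv.
have [_ ige] := critical_degrees notcol gv.
have : 3 <= odeg S v.
  rewrite (_ : 3 = #|[set a; u; u']|); last first.
    rewrite -setUA cardsU1 cards2 uu' !inE.
    have /negbTE-> : a != u by apply: contra_eqN ga => /eqP->; case: (g u).
    have /negbTE-> : a != u' by apply: contra_eqN ga => /eqP->; rewrite guu'; case: (g u').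
    by [].
  apply/subset_leq_card/subsetP => w; rewrite !inE -orbA.
  by case/or3P => /eqP->; apply/andP.
by move: ige (deg4 vS); rewrite card_bool; lia.
Qed.

Lemma hole_in_uniq g v u u' : hole g v -> u \in S -> u' \in S ->
  e u v -> e u' v -> g u = g u' -> u = u'.
Proof.
move=> [vS gv] uS u'S evu evu' guu'; apply/eqP/negPn/negP => uu'.
have [a [aS eva ga]] := critical_in (~~ g u) notcol gv.
have [oge _] := critical_degrees notcol gv.
have : 3 <= ideg S v.
  rewrite (_ : 3 = #|[set a; u; u']|); last first.
    rewrite -setUA cardsU1 cards2 uu' !inE.
    have /negbTE-> : a != u by apply: contra_eqN ga => /eqP->; case: (g u).
    have /negbTE-> : a != u' by apply: contra_eqN ga => /eqP->; rewrite guu'; case: (g u').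
    by [].
  apply/subset_leq_card/subsetP => w; rewrite !inE -orbA.
  by case/or3P => /eqP->; apply/andP.
by move: oge (deg4 vS); rewrite card_bool; lia.
Qed.

(** [v] keeps the color [g v]: its only out-neighbor of that color is [u], the new hole, so [v]
    closes no monochromatic cycle. *)
Lemma hole_move_out g v u :
  hole g v -> u \in S -> e v u -> g u = g v -> hole g u.
Proof.
move=> hv uS evu guv; have [vS gv] := hv; split=> //.
apply: (colors_extend (v := v)).
  by apply: colors_sub gv; rewrite setSD // subD1set.
left=> w; rewrite !inE => /andP[wu wS] evw; apply: contraNneq wu => gwv.
by apply/eqP/(hole_out_uniq hv); rewrite // guv gwv.
Qed.

Lemma hole_move_in g v u :
  hole g v -> u \in S -> e u v -> g u = g v -> hole g u.
Proof.
move=> hv uS euv guv; have [vS gv] := hv; split=> //.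
apply: (colors_extend (v := v)).
  by apply: colors_sub gv; rewrite setSD // subD1set.
right=> w; rewrite !inE => /andP[wu wS] ewv; apply: contraNneq wu => gwv.
by apply/eqP/(hole_in_uniq hv); rewrite // guv gwv.
Qed.

Lemma hole_recolor g v c : hole g v -> hole (recolor g v c) v.
Proof. by move=> [vS gv]; split=> //; exact: colors_recolor. Qed.

(* [Q] is what remains of a monochromatic directed cycle
   y -> s -> ... -> p -> y once its vertex [y] has changed color; the last
   clause expresses that the path [Q] is connected. *)
Definition broken_cycle (g : T -> bool) (Q : {set T}) (y : T) : Prop :=
  {in Q, forall q, q \in S /\ g q = ~~ g y} /\
  exists s p, [/\ s \in Q, p \in Q, s != p, e y s & e p y] /\ y \in S /\
    forall (X : T -> Prop) w, w \in Q -> X w ->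
      {in Q &, forall u u', X u -> e u u' || e u' u -> X u'} -> X s /\ X p.

(* If the hole meets [Q], then it can be moved to [s] as well as to [p], and
   from either of them to [y]. The two colorings with hole [y] differ only at
   [s] and [p], so the second out-neighbor of [y] would need two colors. *)
Lemma broken_cycle_no_hole g Q y w :
  broken_cycle g Q y -> w \in Q -> hole g w -> False.
Proof.
move=> [Qg [s [p [[sQ pQ sp eys epy] [yS conn]]]]] wQ hw.
have [hs hp] : hole g s /\ hole g p.
  apply: conn wQ hw _ => u u' uQ u'Q hu.
  have [u'S gu'] := Qg _ u'Q; have [uS gu] := Qg _ uQ.
  by case/orP => adj; [apply: hole_move_out hu _ _ _ | apply: hole_move_in hu _ _ _];
     rewrite // gu gu'.
have [sS gs] := Qg _ sQ; have [pS gp] := Qg _ pQ.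
have ys : y != s by apply: contra_eqN gs => /eqP->; case: (g s).
have yp : y != p by apply: contra_eqN gp => /eqP->; case: (g p).
have hy1 : hole (recolor g s (g y)) y.
  apply: hole_move_in (hole_recolor (g y) hs) _ _ _ => //.
  by rewrite recolor_at recolor_off.
have hy2 : hole (recolor g p (g y)) y.
  apply: hole_move_out (hole_recolor (g y) hp) _ _ _ => //.
  by rewrite recolor_at recolor_off.
have [s' [s'S eys' gs']] := critical_out (~~ g y) notcol hy1.2.
have ss' : s' != s.
  by apply: contra_eqN gs' => /eqP->; rewrite recolor_at; case: (g y).
rewrite recolor_off // in gs'.
(* An arc from [y] to [p] would form a digon; hence [s'] keeps its color in both recolorings. *)
have s'p : s' != p by apply: contraTneq eys' => ->; exact: no_digon.
move/eqP: ss'; apply; apply: (hole_out_uniq hy2) => //.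
by rewrite !recolor_off // gs.
Qed.

Lemma new_broken_cycle g x x' : hole g x -> x' \in S -> e x x' -> g x' = g x ->
  exists2 Q : {set T}, x \in Q & broken_cycle (recolor g x' (~~ g x)) Q x'.
Proof.
move=> hx x'S exx' gx'; have xS := hx.1.
have hx' : hole g x' by apply: hole_move_out hx _ _ _.
have xx' : x != x' by apply: contraTneq exx' => ->; rewrite e_irr.
have [s [sS ex's gs]] := critical_out (g x) notcol hx'.2.
have sx' : s != x' by apply: contraTneq ex's => ->; rewrite e_irr.
have hs : hole g s by apply: hole_move_out hx' _ _ _; rewrite // gs.
(* The cycle is not traced vertex by vertex: [Q] takes all hole positions of that color but [x'],
   and acyclicity without [x'] makes [Q] connected. *)
pose Q := [set u | `[< hole g u >] && (g u == g x) && (u != x')].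
have QP u : reflect [/\ hole g u, g u = g x & u != x'] (u \in Q).
  rewrite inE; apply: (iffP andP) => [[/andP[/asboolP ? /eqP ?] ?]|[? ? ?]] //.
  by split=> //; apply/andP; split; [apply/asboolP | apply/eqP].
have xQ : x \in Q by apply/QP.
have sQ : s \in Q by apply/QP.
exists Q => //; split.
  move=> q /QP[[qS _] gq qx']; split=> //.
  by rewrite recolor_at recolor_off // gq negbK.
exists s, x; split.
  by split=> //; apply: contraTneq ex's => ->; exact: no_digon.
split=> // X w wQ Xw Xcl.
have [_ gx'c] := hx'.
pose Z := [set u in Q | `[< X u >]].
have ZP u : reflect (u \in Q /\ X u) (u \in Z).
  by apply: (iffP setIdP) => -[? /asboolP].
have ZS : Z \subset S :\ x'.
  by apply/subsetP => u /ZP[/QP[[uS _] _ ux'] _]; rewrite !inE ux'.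
have wZ : w \in Z by apply/ZP.
split; apply: contrapT => nX.
(* Arcs from [x'] enter [Q] only at [s]. If [X] missed [s], every vertex of [Z] would have an
   in-neighbor of its color in [Z]. *)
- apply: (colors_no_backward_closed gx'c ZS wZ) => u /ZP[uQ Xu].
  have [hu gu ux'] := QP _ uQ.
  have [u' [u'S eu'u gu']] := critical_in (g x) notcol hu.2.
  have u'Q : u' \in Q.
    apply/QP; split=> //; first by apply: hole_move_in hu _ _ _; rewrite // gu.
    apply/eqP => u'x'; apply: nX; rewrite u'x' in eu'u.
    by rewrite (hole_out_uniq hx' sS hu.1 ex's eu'u) // gs.
  exists u'; last by rewrite gu gu'.
  by apply/ZP; split=> //; apply: Xcl Xu _; rewrite // eu'u orbT.
(* Dually, arcs to [x'] leave [Q] only at [x]. *)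
- apply: (colors_no_forward_closed gx'c ZS wZ) => u /ZP[uQ Xu].
  have [hu gu ux'] := QP _ uQ.
  have [u' [u'S euu' gu']] := critical_out (g x) notcol hu.2.
  have u'Q : u' \in Q.
    apply/QP; split=> //; first by apply: hole_move_out hu _ _ _; rewrite // gu.
    apply/eqP => u'x'; apply: nX; rewrite u'x' in euu'.
    by rewrite (hole_in_uniq hx' xS hu.1 exx' euu').
  exists u'; last by rewrite gu gu'.
  by apply/ZP; split=> //; apply: Xcl Xu _; rewrite // euu'.
Qed.

(* [W] is the set of vertices recolored so far, the last one being [x]. *)
Definition hole_walk (g : T -> bool) (W : {set T}) (x : T) : Prop :=
  [/\ hole g x, x \in W & forall w, w \in W -> w != x ->
    exists Q y, [/\ broken_cycle g Q y, w \in Q & y \in W]].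

Lemma hole_walk_step g W x : hole_walk g W x ->
  exists g' W' x', hole_walk g' W' x' /\ #|W| < #|W'|.
Proof.
move=> [hx xW old].
have [x' [x'S exx' gx']] := critical_out (g x) notcol hx.2.
have hx' : hole g x' by apply: hole_move_out hx _ _ _.
have x'x : x' != x by apply: contraTneq exx' => ->; rewrite e_irr.
(* The vertices of [W] other than [x] lie on broken cycles, which the hole cannot meet. *)
have x'W : x' \notin W.
  apply/negP => /old/(_ x'x) [Q [y [bQ x'Q _]]].
  exact: broken_cycle_no_hole bQ x'Q hx'.
exists (recolor g x' (~~ g x)), (x' |: W), x'; split; last by rewrite cardsU1 x'W.
split; [exact: hole_recolor | exact: setU11 | ].
move=> w; rewrite in_setU1 => /orP[/eqP-> /eqP //|wW] wx'.
have [->|wx] := eqVneq w x.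
  have [Q xQ bQ] := new_broken_cycle hx x'S exx' gx'.
  by exists Q, x'; rewrite setU11.
have [Q [y [bQ wQ yW]]] := old w wW wx.
exists Q, y; split; rewrite ?in_setU1 ?yW ?orbT //.
(* The older broken cycles survive the recoloring of [x']: it differs from [y], which is in [W], and
   avoids [Q], which the hole cannot meet. *)
have yx' : y != x' by apply: contraNneq x'W => <-.
have [Qg rest] := bQ; split=> // q qQ.
rewrite !recolor_off //; first exact: Qg.
by apply/eqP => qx'; apply: (broken_cycle_no_hole bQ qQ); rewrite qx'.
Qed.

Lemma no_hole g x : ~ hole g x.
Proof.
move=> hx.
have : forall n, exists g W x, hole_walk g W x /\ n <= #|W|.
  elim=> [|n [g' [W [x' [/hole_walk_step[g'' [W' [x'' [walk lt]]]] le]]]]].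
    exists g, [set x], x; split=> //; split; rewrite ?set11 // => w.
    by move/set1P=> ->; rewrite eqxx.
  by exists g'', W', x''; split=> //; exact: leq_ltn_trans lt.
move=> /(_ #|T|.+1) [g' [W [x' [_]]]].
by rewrite ltnNge max_card.
Qed.

End DegreeFour.

Lemma odegS (A B : {set T}) v : A \subset B -> odeg A v <= odeg B v.
Proof.
move=> /subsetP AB; apply/subset_leq_card/subsetP => u.
by rewrite !inE => /andP[/AB-> ->].
Qed.

Lemma idegS (A B : {set T}) v : A \subset B -> ideg A v <= ideg B v.
Proof.
move=> /subsetP AB; apply/subset_leq_card/subsetP => u.
by rewrite !inE => /andP[/AB-> ->].
Qed.

Hypothesis no_digon : forall x y, e x y -> ~~ e y x.

Lemma degree4_two_colorable (A : {set T}) :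
  {in A, forall v, odeg A v + ideg A v <= 4} ->
  exists f : T -> bool, colors A f.
Proof.
move=> dA; apply: contrapT => nA.
have [S [SA nS minS /set0Pn[v vS]]] := minimal_uncolorable (inhabits true) nA.
have [g gv] := minS v vS.
have dS u : u \in S -> odeg S u + ideg S u <= 4.
  move=> uS; apply: leq_trans (dA u (subsetP SA u uS)).
  by rewrite leq_add ?odegS ?idegS.
exact: (no_hole no_digon nS dS) (conj vS gv).
Qed.

(** * Lovász partition and two colors per part *)

Section Partition.
Variables (s : nat) (S : {set T}).

Definition mono_arcs (h : T -> 'I_s) : {set T * T} :=
  [set p | [&& p.1 \in S, p.2 \in S, e p.1 p.2 & h p.1 == h p.2]].

Definition part_deg (h : T -> 'I_s) (v : T) (j : 'I_s) : nat :=
  #|[set u in [set u in S | e v u] | h u == j]| +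
  #|[set u in [set u in S | e u v] | h u == j]|.

Lemma sum_part_deg h v : \sum_j part_deg h v j = odeg S v + ideg S v.
Proof.
have sum_fibers (A : {set T}) : \sum_j #|[set u in A | h u == j]| = #|A|.
  rewrite -sum1_card (partition_big h predT) //=; apply: eq_bigr => j _.
  by rewrite -sum1_card; apply: eq_bigl => u; rewrite inE.
by rewrite big_split /= !sum_fibers.
Qed.

(** Isolates the arcs at [v], so that moving [v] to another part changes only the first term. *)
Lemma card_mono_arcs h v : v \in S ->
  #|mono_arcs h| = part_deg h v (h v) +
    #|[set p in mono_arcs h | (p.1 != v) && (p.2 != v)]|.
Proof.
move=> vS; rewrite -(cardsID [set p | p.1 == v] (mono_arcs h)) /part_deg -addnA.
congr (_ + _).
  rewrite -(card_imset _ (f := @pair T T v)) => [|x y []] //.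
  apply: eq_card => -[x y]; rewrite !inE /=.
  apply/andP/imsetP => [[/and4P[xS yS exy /eqP hxy] /eqP xv]|[u + [-> ->]]].
    by exists y; rewrite ?xv // !inE yS -xv exy hxy eqxx.
  by rewrite !inE eqxx vS => /andP[/andP[-> ->] /eqP->]; rewrite eqxx.
rewrite -(cardsID [set p | p.2 == v] (_ :\: _)); congr (_ + _).
  rewrite -(card_imset _ (f := fun u : T => (u, v))) => [|x y []] //.
  apply: eq_card => -[x y]; rewrite !inE /=.
  apply/andP/imsetP => [[/andP[xv /and4P[xS yS exy /eqP hxy]] /eqP yv]|[u + [-> ->]]].
    by exists x; rewrite ?yv // !inE xS -yv exy hxy eqxx.
  rewrite !inE eqxx vS => /andP[/andP[-> euv] /eqP->]; rewrite euv eqxx.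
  by rewrite !andbT; split=> //; apply: contraTneq euv => ->; rewrite e_irr.
apply: eq_card => -[x y]; rewrite !inE /=.
by rewrite [RHS]andbC andbCA andbA andbA.
Qed.

Lemma part_deg_recolor h v j c : part_deg (recolor h v c) v j = part_deg h v j.
Proof.
by rewrite /part_deg; congr (_ + _); apply: eq_card => u; rewrite !inE /recolor;
  have [->|] := eqVneq u v; rewrite // e_irr !andbF.
Qed.

Lemma degree4_partition : 0 < s ->
  {in S, forall v, odeg S v + ideg S v < 5 * s} ->
  exists h : T -> 'I_s, {in S, forall v, part_deg h v (h v) <= 4}.
Proof.
move=> s_gt0 dS; pose cost (h : {ffun T -> 'I_s}) := #|mono_arcs h|.
pose h := [arg min_(h < [ffun=> Ordinal s_gt0] : {ffun T -> 'I_s}) cost h].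
have hmin h' : cost h <= cost h' by rewrite /h; case: arg_minnP => // k _; apply.
exists h => v vS; rewrite leqNgt; apply/negP => big.
(* The average of [part_deg h v] over the [s] parts is below 5; moving [v] to part [j] would lower
   the cost. *)
have [j small] : exists j, part_deg h v j < 5.
  apply: contrapT => none; have := dS v vS; rewrite -(sum_part_deg h) ltnNge.
  move/negP; apply; rewrite -{1}(card_ord s) mulnC -sum_nat_const leq_sum // => j _.
  by rewrite leqNgt; apply/negP => lt5; apply: none; exists j.
have := hmin (finfun (recolor h v j)).
rewrite /cost (card_mono_arcs h vS) (card_mono_arcs (finfun (recolor h v j)) vS).
have eq_rest : [set p in mono_arcs (finfun (recolor h v j)) | (p.1 != v) && (p.2 != v)]
    = [set p in mono_arcs h | (p.1 != v) && (p.2 != v)].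
  apply/setP => -[x y]; rewrite !inE !ffunE /= /recolor.
  by have [|] := eqVneq x v; have [|] := eqVneq y v; rewrite ?andbF.
have -> : part_deg (finfun (recolor h v j)) v (finfun (recolor h v j) v)
    = part_deg h v j.
  rewrite ffunE recolor_at -(part_deg_recolor h v j j) /part_deg.
  by congr (_ + _); apply: eq_card => u; rewrite !inE ffunE.
by rewrite eq_rest leq_add2r leqNgt (leq_trans small).
Qed.

Lemma two_colors_per_part : 0 < s ->
  {in S, forall v, odeg S v + ideg S v < 5 * s} ->
  exists f : T -> 'I_s * bool, colors S f.
Proof.
move=> s_gt0 /(degree4_partition s_gt0) [h h4].
have /choice[f fP] (i : 'I_s) : exists f : T -> bool, colors [set u in S | h u == i] f.
  apply: degree4_two_colorable => v; rewrite inE => /andP[vS /eqP hv].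
  apply: leq_trans (h4 v vS); rewrite hv leq_add //.
    by apply/subset_leq_card/subsetP => u; rewrite !inE => /andP[/andP[-> ->] ->].
  by apply/subset_leq_card/subsetP => u; rewrite !inE => /andP[/andP[-> ->] ->].
have /choice[r rP] := fP.
exists (fun v => (h v, f (h v) v)), (fun v => r (h v) v) => x y xS yS exy [hxy].
by rewrite hxy; apply: rP; rewrite // inE ?xS ?yS ?hxy eqxx.
Qed.

End Partition.

Lemma degree_product_colorable (s : nat) : 0 < s ->
  (forall v, odeg setT v * ideg setT v < 6 * s ^ 2) ->
  exists f : T -> 'I_s * bool, colors setT f.
Proof.
move=> s_gt0 dT; apply: contrapT => nT.
have [S [_ nS minS _]] :=
  minimal_uncolorable (inhabits (Ordinal s_gt0, true)) nT.
apply/nS/two_colors_per_part => // v vS.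
have [f fv] := minS v vS.
have := critical_degrees nS fv; rewrite card_prod card_ord card_bool => -[lo li].
have := leq_ltn_trans (leq_mul (odegS v (subsetT S)) (idegS v (subsetT S))) (dT v).
(* From [(a - 2s)(b - 2s) >= 0] follows [2s(a + b) <= ab + 4s^2 < 10s^2]. *)
move: lo li; move: (odeg S v) (ideg S v) => a b; nia.
Qed.

End Colors.

(** * Chromatic number and the numerical bound *)

(** Ranks cannot increase all the way around a cycle: its vertex set is forward closed under
    [next]. *)
Lemma coloring_of_colors (D : digraph) (K : finType) (f : D -> K) :
  colors (@darc D) setT f -> is_coloring (fun v => enum_rank (f v)).
Proof.
move=> fP i [c [[c0 /andP[cyc _]] cA]].
have fc x y : x \in c -> y \in c -> f x = f y.
  move=> /cA + /cA; rewrite !inE => /eqP fx /eqP fy.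
  by apply: enum_rank_inj; rewrite fx fy.
case: c c0 cyc cA fc => // x c _ cyc cA fc.
apply: (colors_no_forward_closed (Z := [set u in x :: c]) (w := x) fP (subsetT _)).
  by rewrite !inE eqxx.
move=> u; rewrite inE => uc; exists (next (x :: c) u); first by rewrite inE mem_next.
by split; [exact: next_cycle | apply: fc; rewrite ?mem_next].
Qed.

Lemma chromatic_number_le (D : digraph) (s : nat) :
  digon_free D -> (0 < s)%N ->
  (forall v : D, outdeg v * indeg v < 6 * s ^ 2)%N ->
  (chromatic_number D <= 2 * s)%N.
Proof.
move=> nodigon s_gt0 deg.
have no2 (x y : D) : darc x y -> ~~ darc y x.
  move=> exy; have := nodigon x y; rewrite /digon exy /= negb_and.
  by case/orP => //; rewrite negbK => /eqP xy; move: exy; rewrite xy darc_irr.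
have [v|f fP] := degree_product_colorable (@darc_irr D) no2 s_gt0.
  apply: leq_ltn_trans (deg v); rewrite leq_mul //;
  by apply/subset_leq_card/subsetP => u; rewrite !inE.
rewrite /chromatic_number; case: ex_minnP => k _; apply; apply/asboolP.
have : colorable D #|{: 'I_s * bool}| by eexists; exact: coloring_of_colors fP.
by rewrite card_prod card_ord card_bool mulnC.
Qed.

Lemma degree_product_le (R : realType) (D : digraph) (v : D) :
  (outdeg v * indeg v)%:R <= Delta_tilde D R ^+ 2.
Proof.
have le : Num.sqrt ((outdeg v)%:R * (indeg v)%:R) <= Delta_tilde D R.
  exact: (le_bigmax _ (fun v : D => Num.sqrt ((outdeg v)%:R * (indeg v)%:R : R))).
rewrite natrM -(@sqr_sqrtr R ((outdeg v)%:R * (indeg v)%:R)) ?mulr_ge0 //.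
by rewrite ler_pXn2r // nnegrE ?sqrtr_ge0 // (le_trans _ le) ?sqrtr_ge0.
Qed.

Theorem theorem3 (R : realType) :
  exists Delta1 : R, forall D : digraph,
    digon_free D -> Delta1 <= Delta_tilde D R ->
    (chromatic_number D)%:R <= (1 - expR (- 13)) * Delta_tilde D R.
Proof.
(* For [m >= 100] and [s = floor(9m/20)], [s > 0.44m] gives [6s^2 > m^2], while [2s <= 0.9m] leaves
   room for any [expR (- 13) <= 1/10]. *)
exists 100 => D nodigon; set m := Delta_tilde D R => m_ge.
have exp_le : expR (- 13) <= 10^-1 :> R.
  rewrite expRN lef_pV2 ?posrE ?expR_gt0 //.
  by apply: le_trans (expR_ge1Dx 13); lra.
have z_ge0 : 0 <= 9 / 20 * m by lra.
have /andP[s_le s_gt] := Num.Theory.truncn_itv z_ge0.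
set s := Num.truncn _ in s_le s_gt; rewrite -natr1 in s_gt.
have s_gt0 : (0 < s)%N by rewrite -(ltr_nat R); lra.
have : (chromatic_number D <= 2 * s)%N.
  apply: chromatic_number_le => // v.
  rewrite -(ltr_nat R) (le_lt_trans (degree_product_le R v)) //.
  by rewrite natrM natrX -/m; nra.
by rewrite -(ler_nat R) natrM => chi_le; nra.
Qed.
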